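(* Let $\mathcal A(M_T)$ be a GLP algebra of rank $n$ which is both positive and $\mathbf d$-vector-positive. Then $\mathcal A(M_T)$ has the proper Laurent monomial property, and thus the cluster monomials of $\mathcal A(M_T)$ are linearly independent over $\mathbb{ZP}$.
   Context: Let $\mathbb P$ be a (multiplicative) abelian group whose group ring $\mathbb{ZP}$ is a domain, and let $\mathcal F$ be the field of rational functions in $n$ independent variables with coefficients in $\mathbb{ZP}$. $\mathbb N$ denotes the nonnegative integers; $\mathbb{NP}\subset\mathbb{ZP}$ is the set of nonnegative integer combinations of elements of $\mathbb P$. A cluster in $\mathcal F$ is $X_t=\{x_{1;t},\dots,x_{n;t}\}$ such that $x_{1;t},\dots,x_{n;t}$ form a free generating set of $\mathcal F$ (over the fraction field of $\mathbb{ZP}$); its elements are called cluster variables. Put $\mathcal L(t)=\mathbb{ZP}[x_{1;t}^{\pm1},\dots,x_{n;t}^{\pm1}]$ and $\mathcal L^+(t)=\mathbb{NP}[x_{1;t}^{\pm1},\dots,x_{n;t}^{\pm1}]$. GLP pattern/algebra: for an index set $T$, a family of clusters $M_T=\{X_t\mid t\in T\}$ in $\mathcal F$ is a generalized Laurent phenomenon (GLP) pattern of rank $n$ if $X_{t'}\subseteq\mathcal L(t)$ for all $t,t'\in T$. The associated GLP algebra $\mathcal A(M_T)$ is the $\mathbb{ZP}$-subalgebra of $\mathcal F$ generated by all cluster variables of $M_T$. It is called positive if $X_{t'}\subseteq\mathcal L^+(t)$ for all $t,t'\in T$. $\mathbf d$-vectors: for $t_0\in T$ and a cluster variable $x$ of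 $M_T$, expand $x$ as a Laurent polynomial in $X_{t_0}$ and let $-d_j$ be the minimal exponent of $x_{j;t_0}$ appearing in this expansion; the $\mathbf d$-vector of $x$ with respect to $X_{t_0}$ is $\mathbf d^{t_0}(x)=(d_1,\dots,d_n)^\top\in\mathbb Z^n$. The algebra $\mathcal A(M_T)$ is $\mathbf d$-vector-positive if for every cluster variable $x$ of $M_T$ and every $t\in T$, either $x\in X_t$ or $\mathbf d^{t}(x)\in\mathbb N^n$. Cluster monomials: for $\mathbf a\in\mathbb Z^n$ write $\mathbf x_t^{\mathbf a}=\prod_{i=1}^n x_{i;t}^{a_i}$. It is a cluster monomial in $X_t$ if $\mathbf a\in\mathbb N^n$, and a proper Laurent monomial in $X_t$ if $\mathbf a\notin\mathbb N^n$. $CM(t)$ is the set of cluster monomials in $X_t$; the cluster monomials of $\mathcal A(M_T)$ are the elements of $\bigcup_{t\in T}CM(t)\subset\mathcal F$. Proper Laurent monomial property: $\mathcal A(M_T)$ has this property with respect to $X_{t_0}$ if for every $t\in T$, every cluster monomial in $CM(t)\setminus CM(t_0)$ is a $\mathbb{ZP}$-linear combination of proper Laurent monomials in $X_{t_0}$; it has the proper Laurent monomial property if this holds with respect to every cluster $X_{t_0}$, $t_0\in T$. *)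

(* Defs.v *)
From HB Require Import structures.
From mathcomp Require Import all_boot all_order all_algebra.
From mathcomp Require Import finmap boolp.
From mathcomp Require Import monalg mpoly.

Set Implicit Arguments.
Unset Strict Implicit.
Unset Printing Implicit Defensive.

Import Order.TTheory GRing.Theory Num.Theory.

Local Open Scope ring_scope.

(* In [mpoly] and [monalg] the names [msupp] and [mcoeff] clash; the notations
   below always denote the [monalg] versions, i.e. the support and the
   coefficients of a finitely supported function. *)
Notation supp g := (monalg.msupp g).
Notation coef k g := (monalg.mcoeff k g).
Notation single c k := (monalg.mkmalgU k c).

(* The group ring ZP of an abelian group P. The group is written additively, as
   usual for a [zmodType]: the element p of P, seen in ZP, is [gelt p], and
   gelt (p + q) = gelt p * gelt q. The algebra structure of [monalg] itself
   is not available here, because it excludes monoids with nontrivial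
   invertible elements. *)
Definition group_ring (P : zmodType) : Type := {malg int[P]}.

HB.instance Definition _ (P : zmodType) :=
  GRing.Zmodule.copy (group_ring P) {malg int[P]}.

Section GroupRing.
Context (P : zmodType).
Implicit Types (g : group_ring P) (p q : P) (c : int).

Definition gelt p : group_ring P := single 1 p.

Definition gone : group_ring P := gelt 0.

Definition gmul g1 g2 : group_ring P :=
  \sum_(p <- supp g1) \sum_(q <- supp g2)
    single (coef p g1 * coef q g2) (p + q).

Lemma gmulw (d1 d2 : {fset P}) g1 g2 :
  (supp g1 `<=` d1)%fset -> (supp g2 `<=` d2)%fset ->
  gmul g1 g2 = \sum_(p <- d1) \sum_(q <- d2)
    single (coef p g1 * coef q g2) (p + q).
Proof.
move=> le1 le2; rewrite /gmul (big_fset_incl _ le1) /=.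
  apply/eq_bigr=> p _; apply/big_fset_incl => // q _ /mcoeff_outdom ->.
  by rewrite mulr0 monalgU0.
move=> p _ /mcoeff_outdom g1p.
by rewrite big1 => // q _; rewrite g1p mul0r monalgU0.
Qed.

Lemma gmulC : commutative gmul.
Proof.
move=> g1 g2; rewrite /gmul exchange_big /=.
by apply: eq_bigr => q _; apply: eq_bigr => p _; rewrite mulrC addrC.
Qed.

Lemma gmul0g : left_zero 0 gmul.
Proof. by move=> g; rewrite /gmul monalg.msupp0 big_seq_fset0. Qed.

Lemma gmulUU c1 c2 p q : gmul (single c1 p) (single c2 q) = single (c1 * c2) (p + q).
Proof.
by rewrite (gmulw monalg.msuppU_le monalg.msuppU_le) !big_seq_fset1 !mcoeffUU.
Qed.

Lemma gmul1g : left_id gone gmul.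
Proof.
move=> g; rewrite (gmulw monalg.msuppU_le (fsubset_refl _)) big_seq_fset1.
rewrite [RHS]monalgE; apply: eq_bigr => q _.
by rewrite mcoeffUU mul1r add0r.
Qed.

Lemma gmulDl : left_distributive gmul +%R.
Proof.
move=> g1 g2 g.
rewrite [in RHS](gmulw (fsubsetUl _ (supp g2)) (fsubset_refl _)).
rewrite [in RHS](gmulw (fsubsetUr (supp g1) _) (fsubset_refl _)).
rewrite (gmulw (monalg.msuppD_le _ _) (fsubset_refl _)) -big_split /=.
apply: eq_bigr => p _; rewrite -big_split /=; apply: eq_bigr => q _.
by rewrite monalg.mcoeffD mulrDl monalgUD.
Qed.

Lemma gmulDr : right_distributive gmul +%R.
Proof. by move=> g g1 g2; rewrite gmulC gmulDl !(gmulC g). Qed.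

Lemma gmul_suml (I : Type) (s : seq I) (f : I -> group_ring P) g :
  gmul (\sum_(i <- s) f i) g = \sum_(i <- s) gmul (f i) g.
Proof.
by rewrite (big_morph (gmul^~ g) (fun _ _ => gmulDl _ _ _) (gmul0g _)).
Qed.

Lemma gmul_sumr (I : Type) (s : seq I) (f : I -> group_ring P) g :
  gmul g (\sum_(i <- s) f i) = \sum_(i <- s) gmul g (f i).
Proof.
by rewrite gmulC gmul_suml; apply: eq_bigr => i _; rewrite gmulC.
Qed.

Lemma gmulA : associative gmul.
Proof.
move=> g1 g2 g3; rewrite (monalgE g1).
rewrite (gmul_suml _ _ (gmul g2 g3)) (gmul_suml _ _ g2) (gmul_suml _ _ g3).
apply: eq_bigr => p _; set u := single _ p; rewrite (monalgE g2).
rewrite (gmul_suml _ _ g3) (gmul_sumr _ _ u) (gmul_sumr _ _ u).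
rewrite (gmul_suml _ _ g3); apply: eq_bigr => q _; set v := single _ q.
rewrite (monalgE g3) (gmul_sumr _ _ v) (gmul_sumr _ _ u) (gmul_sumr _ _ (gmul u v)).
apply: eq_bigr => r _.
by rewrite /u /v !gmulUU mulrA addrA.
Qed.

Lemma gone_neq0 : gone != 0.
Proof. by apply/eqP => /malgP /(_ 0) /eqP; rewrite mcoeffUU monalg.mcoeff0. Qed.

HB.instance Definition _ := GRing.Zmodule_isComNzRing.Build (group_ring P)
  gmulA gmulC gmul1g gmulDl gone_neq0.

Lemma geltD p q : gelt (p + q) = gelt p * gelt q.
Proof. by rewrite [RHS]gmulUU mulr1. Qed.

(* Invertibility is decided classically. *)
Definition gunit : pred (group_ring P) := fun g => `[< exists h, h * g = 1 >].

Definition ginv g : group_ring P :=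
  if pselect (exists h, h * g = 1) is left ex then projT1 (cid ex) else g.

Lemma gmulVg : {in gunit, left_inverse 1 ginv *%R}.
Proof.
move=> g /asboolP ex; rewrite /ginv; case: pselect => // ex'.
exact: (projT2 (cid ex')).
Qed.

Lemma gunitP g h : h * g = 1 -> gunit g.
Proof. by move=> gh; apply/asboolP; exists h. Qed.

Lemma ginv_out : {in [predC gunit], ginv =1 id}.
Proof. by move=> g /asboolP nex; rewrite /ginv; case: pselect. Qed.

HB.instance Definition _ := GRing.ComNzRing_hasMulInverse.Build (group_ring P)
  gmulVg gunitP ginv_out.

End GroupRing.

(* The group ring, packed as an integral domain under the hypothesis that it is
   one. *)
Definition group_domain (P : zmodType)
  (dom : GRing.integral_domain_axiom (group_ring P)) : Type := group_ring P.

HB.instance Definition _ (P : zmodType)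
    (dom : GRing.integral_domain_axiom (group_ring P)) :=
  GRing.ComUnitRing.copy (group_domain dom) (group_ring P).

HB.instance Definition _ (P : zmodType)
    (dom : GRing.integral_domain_axiom (group_ring P)) :=
  GRing.ComUnitRing_isIntegral.Build (group_domain dom) dom.

Section GLP.
Context (P : zmodType) (dom : GRing.integral_domain_axiom (group_ring P)).
Context (n : nat).

Local Notation ZP := (group_domain dom).

(* [mpoly n ZP] is written out because [monalg] and [mpoly] both define the
   notation for polynomial types. *)
Definition rat_fun : fieldType := {fraction (mpoly n ZP)}.

Local Notation F := rat_fun.

Definition ratC (c : ZP) : F := FracField.tofrac (mpolyC n c).

(* NP, the nonnegative integer combinations of elements of P. *)
Definition NP (c : ZP) : Prop := forall p : P, 0 <= coef p (c : group_ring P).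

(* The fraction field of ZP, inside F. *)
Definition base_field (f : F) : Prop :=
  exists c d : ZP, d != 0 /\ f = ratC c / ratC d.

Definition alg_independent (x : 'I_n -> F) : Prop :=
  forall p : mpoly n F,
    (forall m, base_field (mpoly.mcoeff m p)) -> p.@[x] = 0 -> p = 0.

Definition generates_field (x : 'I_n -> F) : Prop :=
  forall S : {pred F}, divring_closed S ->
    (forall f, base_field f -> f \in S) -> (forall i, x i \in S) ->
    forall f, f \in S.

(* A cluster is given with a labelling; by algebraic independence its n
   elements are pairwise distinct and nonzero. *)
Definition cluster (x : 'I_n -> F) : Prop :=
  alg_independent x /\ generates_field x.

Definition expt := {ffun 'I_n -> int}.

Definition nonneg_expt (a : expt) : bool := [forall i, 0 <= a i].

Definition lmonom (x : 'I_n -> F) (a : expt) : F := \prod_i x i ^ a i.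

(* Laurent polynomials with coefficients in ZP, as finitely supported functions
   on exponents, and their values at x. *)
Definition laurent := {malg ZP[expt]}.

Definition leval (x : 'I_n -> F) (L : laurent) : F :=
  \sum_(a <- supp L) ratC (coef a L) * lmonom x a.

Definition laurent_ring (x : 'I_n -> F) (f : F) : Prop :=
  exists L : laurent, f = leval x L.

Definition pos_laurent (x : 'I_n -> F) (f : F) : Prop :=
  exists2 L : laurent, (forall a, NP (coef a L)) & f = leval x L.

Definition cluster_monomial (x : 'I_n -> F) (f : F) : Prop :=
  exists2 a, nonneg_expt a & f = lmonom x a.

Definition proper_combination (x : 'I_n -> F) (f : F) : Prop :=
  exists2 L : laurent,
    (forall a, a \in supp L -> ~~ nonneg_expt a) & f = leval x L.

(* d is the d-vector of f with respect to x: - d j is the minimal exponent of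
   x j in the expansion of f. *)
Definition is_dvector (x : 'I_n -> F) (f : F) (d : expt) : Prop :=
  exists L : laurent,
    [/\ f = leval x L,
        forall j a, a \in supp L -> - d j <= a j
      & forall j, exists2 a, a \in supp L & a j = - d j].

(* Being positive, being d-vector-positive, having the proper Laurent monomial
   property and being a cluster monomial are notions attached to the
   ZP-subalgebra A(M) generated by the cluster variables, but they are defined
   in terms of the pattern M alone, so A(M) itself is not needed. *)
Section Pattern.
Context (T : Type) (M : T -> 'I_n -> F).

Definition cluster_var (f : F) : Prop := exists t i, f = M t i.

Definition GLP_pattern : Prop :=
  (forall t, cluster (M t)) /\ (forall t t' i, laurent_ring (M t) (M t' i)).

Definition positive_pattern : Prop := forall t t' i, pos_laurent (M t) (M t' i).

Definition dvector_positive : Prop :=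
  forall f, cluster_var f -> forall t,
    (exists i, f = M t i) \/
    (exists2 d, is_dvector (M t) f d & forall j, 0 <= d j).

Definition proper_laurent_wrt (t0 : T) : Prop :=
  forall t f, cluster_monomial (M t) f -> ~ cluster_monomial (M t0) f ->
    proper_combination (M t0) f.

Definition proper_laurent : Prop := forall t0, proper_laurent_wrt t0.

Definition cluster_monomials (f : F) : Prop :=
  exists t, cluster_monomial (M t) f.

End Pattern.

Definition lin_independent (A : F -> Prop) : Prop :=
  forall (s : seq F) (c : F -> ZP), uniq s -> (forall f, f \in s -> A f) ->
    \sum_(f <- s) ratC (c f) * f = 0 -> forall f, f \in s -> c f = 0.

End GLP.

(* Main.v *)
Require Import Defs.
From mathcomp Require Import all_boot all_order all_algebra.
From HB Require Import structures.
From mathcomp Require Import finmap boolp.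
From mathcomp Require Import monalg mpoly.

Set Implicit Arguments.
Unset Strict Implicit.
Unset Printing Implicit Defensive.

Import Order.TTheory GRing.Theory Num.Theory.

Local Open Scope ring_scope.

(** Let x and X be two clusters of the pattern and let f be the cluster monomial
    of exponent a in x. By positivity, f has a Laurent expansion in X with
    coefficients in NP. Suppose that this expansion contains a monomial in X
    whose exponent b is nonnegative; the claim is that f is then a cluster
    monomial in X, because every x_k with a_k > 0 occurs in X
    ([shared_variable]).

    Suppose on the contrary that x_k does not occur in X, and specialize: x_k
    to 1/2, the other variables of x to 1, and ZP to the rationals by the
    augmentation. Every X_j then takes a value at least 1
    ([specialization_ge1]). This is clear if X_j is a variable of x other than
    x_k. Otherwise the k-th entry of the d-vector of X_j is nonnegative, so the
    expansion of X_j in x has a term where x_k has exponent at most 0; that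
    term alone contributes at least 1, and by positivity the others cannot
    compensate it. In the same way the term of exponent b in the expansion of f
    in X has value at least 1, and so has f. But f specializes to (1/2)^a_k,
    hence a_k = 0.

    Specialization is defined on Laurent polynomials in x, and the expansion of
    f in X has denominators that need not be invertible there. Multiplying by a
    large monomial in X removes them, and that monomial can be cancelled
    afterwards because the values of the X_j are nonzero
    ([specializes_laurent]).

    Linear independence follows by reading off one coefficient
    ([proper_laurent_independent]): in a linear relation expand everything in a
    cluster X for which a given f0 of the relation is a cluster monomial, with
    exponent b. The other cluster monomials in X have other exponents, and the
    proper combinations contain no monomial of nonnegative exponent, so f0 alone
    contributes to the coefficient of exponent b. *)

(** * Products of finitely supported functions on an abelian group *)

Section Convolution.
Context (R : comNzRingType) (A : zmodType).
Implicit Types L : {malg R[A]}.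

(** Over the integers this is the product of the group ring; with coefficients
    in ZP and exponents as keys it is the product of Laurent polynomials. *)
Definition convolution L1 L2 : {malg R[A]} :=
  \sum_(a <- supp L1) \sum_(b <- supp L2)
    single (coef a L1 * coef b L2) (a + b).

Lemma mmap_convolution (S : comNzRingType) (h : {rmorphism R -> S}) (e : A -> S)
    L1 L2 :
  {morph e : a b / a + b >-> a * b} ->
  monalg.mmap h e (convolution L1 L2) =
    monalg.mmap h e L1 * monalg.mmap h e L2.
Proof.
move=> eD; rewrite raddf_sum /= [in RHS]/monalg.mmap mulr_suml.
apply: eq_bigr => a _; rewrite raddf_sum /= mulr_sumr; apply: eq_bigr => b _.
by rewrite monalg.mmapU /= rmorphM eD mulrACA.
Qed.

Lemma convolution_closed (S : R -> Prop) L1 L2 :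
  S 0 -> (forall c d, S c -> S d -> S (c + d)) ->
  (forall c d, S c -> S d -> S (c * d)) ->
  (forall a, S (coef a L1)) -> (forall a, S (coef a L2)) ->
  forall a, S (coef a (convolution L1 L2)).
Proof.
move=> S0 SD SM S1 S2 a; rewrite raddf_sum; elim/big_ind: _ => // b _.
rewrite raddf_sum; elim/big_ind: _ => // c _ /=.
by rewrite mcoeffU; case: eqP => _; rewrite ?mulr0n // mulr1n; apply: SM.
Qed.

End Convolution.

(** * Evaluation of Laurent polynomials *)

Section Evaluation.
Context (P : zmodType) (dom : GRing.integral_domain_axiom (group_ring P)).
Context (n : nat).

Local Notation ZP := (group_domain dom).
Local Notation F := (rat_fun dom n).
Implicit Types (L : laurent dom n) (a b : expt n) (c : ZP).

HB.instance Definition _ :=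
  GRing.RMorphism.copy (@ratC P dom n)
    (@FracField.tofrac (mpoly n ZP) \o @mpolyC n ZP).

Lemma ratC_eq0 c : (ratC n c == 0) = (c == 0).
Proof. by rewrite /ratC tofrac_eq0 mpolyC_eq0. Qed.

Lemma base_field_ratC c : base_field (ratC n c).
Proof. by exists c, 1; rewrite oner_neq0 rmorph1 divr1. Qed.

Definition monomial_at (K : fieldType) (y : 'I_n -> K) a : K :=
  \prod_i y i ^ a i.

Lemma monomial_atD (K : fieldType) (y : 'I_n -> K) :
  (forall i, y i != 0) -> {morph monomial_at y : a b / a + b >-> a * b}.
Proof.
move=> y0 a b; rewrite -big_split /=; apply: eq_bigr => i _.
by rewrite ffunE expfzDr.
Qed.

Lemma monomial_at0 (K : fieldType) (y : 'I_n -> K) : monomial_at y 0 = 1.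
Proof. by apply: big1 => i _; rewrite ffunE expr0z. Qed.

Definition unit_expt (i : 'I_n) : expt n := [ffun k => (k == i)%:Z].

Lemma monomial_at_unit (K : fieldType) (y : 'I_n -> K) i :
  monomial_at y (unit_expt i) = y i.
Proof.
rewrite /monomial_at (bigD1 i) //= ffunE eqxx expr1z big1 ?mulr1 // => k ki.
by rewrite ffunE (negbTE ki) expr0z.
Qed.

Lemma monomial_at_neq0 (K : fieldType) (y : 'I_n -> K) a :
  (forall i, y i != 0) -> monomial_at y a != 0.
Proof. by move=> y0; apply/prodf_neq0 => i _; rewrite expfz_neq0. Qed.

Definition laurent_at (K : fieldType) (h : {rmorphism ZP -> K})
    (y : 'I_n -> K) L : K :=
  monalg.mmap h (monomial_at y) L.

HB.instance Definition _ (K : fieldType) (h : {rmorphism ZP -> K})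
    (y : 'I_n -> K) :=
  Algebra.Additive.copy (laurent_at h y) (monalg.mmap h (monomial_at y)).

Lemma laurent_atZ (K : fieldType) (h : {rmorphism ZP -> K}) (y : 'I_n -> K)
    c L :
  laurent_at h y (c *: L) = h c * laurent_at h y L.
Proof.
rewrite malgZ_def raddf_sum mulr_sumr; apply: eq_bigr => a _ /=.
by rewrite /laurent_at monalg.mmapU /= rmorphM mulrA.
Qed.

Lemma levalE (x : 'I_n -> F) L : leval x L = laurent_at (@ratC P dom n) x L.
Proof. by []. Qed.

Lemma cluster_neq0 (x : 'I_n -> F) : cluster x -> forall i, x i != 0.
Proof.
move=> [indep _] i; apply/eqP => xi0.
have /mpolyP /(_ U_(i)%MM) /eqP : ('X_i : mpoly n F) = 0.
  apply: indep => [m|]; last by rewrite mevalXU.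
  rewrite mcoeffX -(rmorph_nat (@ratC P dom n)); exact: base_field_ratC.
by rewrite mcoeffX eqxx mpoly.mcoeff0 oner_eq0.
Qed.


(** Multiplication by one monomial turns a Laurent polynomial into a
    polynomial. *)
Lemma nonneg_translate L :
  exists2 N : expt n, forall i, 0 <= N i &
    forall a, a \in supp L -> forall i, 0 <= (a + N) i.
Proof.
exists [ffun i => (\sum_(a <- supp L) `|a i|%N)%N%:Z] => [i|a aL i].
  by rewrite ffunE.
rewrite !ffunE (big_rem _ aL) /= PoszD addrA addr_ge0 // abszE -lerBlDl sub0r.
by rewrite lerNl lerNnormlW.
Qed.

Lemma laurent_at_shift (K : fieldType) (h : {rmorphism ZP -> K})
    (y : 'I_n -> K) L N :
  (forall i, y i != 0) ->
  laurent_at h y L * monomial_at y N =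
    \sum_(a <- supp L) h (coef a L) * monomial_at y (a + N).
Proof.
move=> y0; rewrite /laurent_at /monalg.mmap mulr_suml; apply: eq_bigr => a _.
by rewrite -mulrA monomial_atD.
Qed.

(** Clearing denominators makes a Laurent relation between the variables a
    polynomial relation over the fraction field of ZP, which algebraic
    independence forbids. *)
Lemma leval_eq0 (x : 'I_n -> F) L : cluster x -> leval x L = 0 -> L = 0.
Proof.
move=> clx xL0; have x0 := cluster_neq0 clx; have [indep _] := clx.
have [N _ LN] := nonneg_translate L.
pose s a := [multinom `|((a + N) i)%R|%N | i < n].
(* The exponents a + N are nonnegative on the support, so the absolute value
   does not identify any of them. *)
have s_inj : {in supp L &, injective s}.
  move=> a b aL bL /mnmP ab; apply: (addIr N); apply/ffunP => i.
  have := ab i; rewrite !mnmE => e.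
  by rewrite -[LHS]gez0_abs ?LN // e gez0_abs ?LN.
pose p : mpoly n F := \sum_(a <- supp L) ratC n (coef a L) *: 'X_[s a].
have coefp m : mpoly.mcoeff m p =
    ratC n (\sum_(a <- supp L) coef a L * (s a == m)%:R).
  rewrite raddf_sum rmorph_sum; apply: eq_bigr => a _ /=.
  by rewrite mpoly.mcoeffZ mcoeffX rmorphM rmorph_nat.
have p0 : p = 0.
  apply: indep => [m|]; first by rewrite coefp; exact: base_field_ratC.
  transitivity (leval x L * monomial_at x N); last by rewrite xL0 mul0r.
  rewrite raddf_sum levalE laurent_at_shift //= big_seq [RHS]big_seq.
  apply: eq_bigr => a aL.
  rewrite mevalZ mevalX; congr (_ * _); apply: eq_bigr => i _.
  by rewrite mnmE -{2}[(a + N) i]gez0_abs ?LN.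
apply/malgP => b; rewrite monalg.mcoeff0.
case: (boolP (b \in supp L)) => [bL|]; last exact: mcoeff_outdom.
have /eqP := coefp (s b).
rewrite p0 mpoly.mcoeff0 eq_sym ratC_eq0 (big_rem b) //= eqxx mulr1.
rewrite big_seq big1 ?addr0 => [/eqP //|a].
rewrite mem_rem_uniq ?fset_uniq // inE => /andP[/negbTE ab aL].
by rewrite (inj_in_eq s_inj) // ab mulr0.
Qed.

Lemma leval_inj (x : 'I_n -> F) : cluster x -> injective (leval x).
Proof.
move=> clx L1 L2 e; apply/eqP; rewrite -subr_eq0; apply/eqP.
by apply: (leval_eq0 clx); rewrite levalE raddfB /= -!levalE e subrr.
Qed.


(** * Specialization of the variables of a cluster *)

Section Specialization.
Context (x : 'I_n -> F) (clx : cluster x).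
Context (K : fieldType) (h : {rmorphism ZP -> K}) (y : 'I_n -> K).
Hypothesis y0 : forall i, y i != 0.

(** The graph of the ring morphism from the Laurent ring of x to K that extends
    h and sends x to y. A relation avoids giving a total value on F, most of
    which lies outside of the Laurent ring. *)
Definition specializes (f : F) (q : K) : Prop :=
  exists2 L, f = leval x L & q = laurent_at h y L.

(** Laurent expansions in a cluster are unique. *)
Lemma specializes_fun f q q' : specializes f q -> specializes f q' -> q = q'.
Proof. by move=> [L -> ->] [L' /(leval_inj clx) -> ->]. Qed.

Lemma specializesD f g q r :
  specializes f q -> specializes g r -> specializes (f + g) (q + r).
Proof.
by move=> [L -> ->] [L' -> ->]; exists (L + L'); rewrite ?levalE raddfD.
Qed.

Lemma specializesM f g q r :
  specializes f q -> specializes g r -> specializes (f * g) (q * r).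
Proof.
move=> [L -> ->] [L' -> ->]; exists (convolution L L'); rewrite ?levalE.
  by rewrite -mmap_convolution //; apply/monomial_atD/(cluster_neq0 clx).
by rewrite -mmap_convolution //; apply: monomial_atD.
Qed.

Lemma specializes_single c a :
  specializes (ratC n c * monomial_at x a) (h c * monomial_at y a).
Proof. by exists (single c a); rewrite ?levalE /laurent_at monalg.mmapU. Qed.

Lemma specializesC c : specializes (ratC n c) (h c).
Proof.
by have := specializes_single c 0; rewrite !monomial_at0 !mulr1.
Qed.

Lemma specializes_var i : specializes (x i) (y i).
Proof.
have := specializes_single 1 (unit_expt i).
by rewrite !monomial_at_unit !rmorph1 !mul1r.
Qed.

Lemma specializes1 : specializes 1 1.
Proof. by have := specializesC 1; rewrite !rmorph1. Qed.

Lemma specializes_sum (I : eqType) (s : seq I) (f : I -> F) (q : I -> K) :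
  (forall i, i \in s -> specializes (f i) (q i)) ->
  specializes (\sum_(i <- s) f i) (\sum_(i <- s) q i).
Proof.
move=> fq; rewrite big_seq [X in specializes _ X]big_seq.
elim/big_rec2: _ => [|i r g /fq fqi gr]; last exact: specializesD.
by have := specializesC 0; rewrite !rmorph0.
Qed.

Lemma specializes_monomial (X : 'I_n -> F) (p : 'I_n -> K) a :
  (forall j, specializes (X j) (p j)) -> (forall i, 0 <= a i) ->
  specializes (monomial_at X a) (monomial_at p a).
Proof.
move=> Xp a0; rewrite /monomial_at.
elim/big_rec2: _ => [|i r g _ gr]; first exact: specializes1.
apply: specializesM gr; rewrite -(gez0_abs (a0 i)) -!exprnP.
elim: absz => [|k IH]; first exact: specializes1.
by rewrite !exprS; apply: specializesM.
Qed.

(** A change of cluster: although the inverses of the X_j need not belong to the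
    Laurent ring of x, the value of an element of that ring can be computed from
    its expansion in X, as soon as the values of the X_j are nonzero. *)
Lemma specializes_laurent (X : 'I_n -> F) (p : 'I_n -> K) L q :
  (forall j, X j != 0) -> (forall j, p j != 0) ->
  (forall j, specializes (X j) (p j)) -> specializes (leval X L) q ->
  q = laurent_at h p L.
Proof.
move=> X0 p0 Xp Lq; have [N N0 LN] := nonneg_translate L.
apply: (mulIf (monomial_at_neq0 N p0)).
apply: specializes_fun (specializesM Lq (specializes_monomial Xp N0)) _.
rewrite levalE !laurent_at_shift //; apply: specializes_sum => a aL.
apply: specializesM (specializesC _) _; apply: specializes_monomial => // i.
exact: LN.
Qed.

End Specialization.


(** * Cluster monomials *)

Lemma monomial_at_closed (K : fieldType) (S : K -> Prop) (y : 'I_n -> K) a :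
  S 1 -> (forall u v, S u -> S v -> S (u * v)) ->
  (forall i, 0 < a i -> S (y i)) -> nonneg_expt a -> S (monomial_at y a).
Proof.
move=> S1 SM Sy /forallP a0; apply: big_ind => // i _.
have := Sy i; rewrite -(gez0_abs (a0 i)) -exprnP.
case: absz => [|k] // /(_ isT) Syi.
by elim: k => [|k IH]; rewrite ?expr1 // exprS; apply: SM.
Qed.

Lemma cluster_monomial1 (X : 'I_n -> F) : cluster_monomial X 1.
Proof.
exists 0; first by apply/forallP => i; rewrite ffunE.
by rewrite -[RHS]/(monomial_at X 0) monomial_at0.
Qed.

Lemma cluster_monomialM (X : 'I_n -> F) f g :
  cluster X -> cluster_monomial X f -> cluster_monomial X g ->
  cluster_monomial X (f * g).
Proof.
move=> clX [a /forallP a0 ->] [b /forallP b0 ->]; exists (a + b).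
  by apply/forallP => i; rewrite ffunE addr_ge0.
by rewrite -monomial_atD //; apply: cluster_neq0.
Qed.

Lemma cluster_monomial_var (X : 'I_n -> F) j : cluster_monomial X (X j).
Proof.
exists (unit_expt j); first by apply/forallP => i; rewrite ffunE.
by rewrite -[RHS]/(monomial_at X _) monomial_at_unit.
Qed.

(** * Positivity *)

Definition augmentation (c : ZP) : rat :=
  monalg.mmap (intmul 1) (fun=> 1) (c : {malg int[P]}).

Fact augmentation_monoid_morphism : GRing.monoid_morphism augmentation.
Proof.
split=> [|c d]; first by rewrite /augmentation monalg.mmapU mulr1.
by apply: (mmap_convolution (intmul 1)) => p q; rewrite mulr1.
Qed.

HB.instance Definition _ :=
  Algebra.Additive.copy augmentation
    (monalg.mmap (intmul 1) (fun=> 1) : {malg int[P]} -> rat).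

HB.instance Definition _ := GRing.isMonoidMorphism.Build ZP rat augmentation
  augmentation_monoid_morphism.

Lemma augmentation_ge0 c : NP c -> 0 <= augmentation c.
Proof. by move=> c0; apply: sumr_ge0 => p _; rewrite mulr1 ler0z. Qed.

(** The value is a sum of nonnegative integers that are not all zero. *)
Lemma augmentation_ge1 c : NP c -> c != 0 -> 1 <= augmentation c.
Proof.
move=> c0 /eqP nz.
have [p pc] : exists p : P, p \in supp (c : {malg int[P]}).
  apply: contrapT => nex; apply: nz; apply/malgP => p; rewrite monalg.mcoeff0.
  by apply: mcoeff_outdom; apply/negP => pc; apply: nex; exists p.
rewrite /augmentation /monalg.mmap (big_rem _ pc) /= mulr1 -[leLHS]addr0.
rewrite lerD //.
  by rewrite ler1z -gtz0_ge1 lt_neqAle eq_sym mcoeff_neq0 pc c0.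
by apply: sumr_ge0 => q _; rewrite mulr1 ler0z.
Qed.

Lemma NPD c d : NP c -> NP d -> NP (c + d).
Proof. by move=> c0 d0 p; rewrite monalg.mcoeffD addr_ge0. Qed.

Lemma NPM c d : NP c -> NP d -> NP (c * d).
Proof.
move=> c0 d0; apply: (@convolution_closed _ _ (fun z : int => 0 <= z)) => //.
  exact: addr_ge0.
exact: mulr_ge0.
Qed.

Lemma NP0 : NP (0 : ZP).
Proof. by move=> p; rewrite monalg.mcoeff0. Qed.

Lemma NP1 : NP (1 : ZP).
Proof. by move=> p; rewrite mcoeffU; case: eqP. Qed.

Lemma pos_laurent1 (x : 'I_n -> F) : pos_laurent x 1.
Proof.
exists (single 1 0) => [a|].
  by rewrite mcoeffU; case: eqP => _; [apply: NP1 | apply: NP0].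
by rewrite levalE /laurent_at monalg.mmapU /= rmorph1 mul1r monomial_at0.
Qed.

Lemma pos_laurentM (x : 'I_n -> F) f g :
  cluster x -> pos_laurent x f -> pos_laurent x g -> pos_laurent x (f * g).
Proof.
move=> clx [L L0 ->] [L' L'0 ->]; exists (convolution L L').
  by apply: convolution_closed => //; [apply: NP0 | apply: NPD | apply: NPM].
rewrite !levalE -mmap_convolution //; exact/monomial_atD/(cluster_neq0 clx).
Qed.

(** Positivity forbids cancellation: each term is a lower bound for the value,
    and its coefficient has augmentation at least 1. *)
Lemma laurent_at_ge_monomial (y : 'I_n -> rat) L b :
  (forall i, 0 < y i) -> (forall a, NP (coef a L)) -> b \in supp L ->
  monomial_at y b <= laurent_at augmentation y L.
Proof.
move=> y0 L0 bL; have mon0 a : 0 <= monomial_at y a.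
  by apply: prodr_ge0 => i _; apply/exprz_ge0/ltW.
rewrite /laurent_at /monalg.mmap (big_rem _ bL) /= -[leLHS]addr0 lerD //.
  by rewrite ler_peMl // augmentation_ge1 // mcoeff_neq0.
by apply: sumr_ge0 => a _; rewrite mulr_ge0 // augmentation_ge0.
Qed.

(** Any rational number strictly between 0 and 1 would do instead of 1/2. *)
Definition half_at (k i : 'I_n) : rat := if i == k then 2^-1 else 1.

Lemma half_at_gt0 k i : 0 < half_at k i.
Proof. by rewrite /half_at; case: eqP. Qed.

Lemma monomial_at_half k a : monomial_at (half_at k) a = 2^-1 ^ a k.
Proof.
rewrite /monomial_at (bigD1 k) //= /half_at eqxx big1 ?mulr1 // => i /negbTE ->.
exact: exp1rz.
Qed.

(** * Comparison of two clusters *)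

Section TwoClusters.
Context (x X : 'I_n -> F).
Hypotheses (clx : cluster x) (clX : cluster X).
Hypothesis pos_X : forall j, pos_laurent x (X j).
Hypothesis pos_x : forall i, pos_laurent X (x i).
Hypothesis dvec_X : forall j,
  (exists i, X j = x i) \/
  (exists2 d, is_dvector x (X j) d & forall i, 0 <= d i).

(** The only variable with a value below 1 is x_k. A variable of X outside of x
    has, by d-vector-positivity, a term in which x_k has exponent at most 0, and
    the value of that monomial is at least 1. *)
Lemma specialization_ge1 k :
  (forall j, X j <> x k) -> forall j, exists2 q : rat,
    specializes x augmentation (half_at k) (X j) q & 1 <= q.
Proof.
move=> Xk j; have [[i Xji]|[d [L [XjL _ Lmin]] d0]] := dvec_X j.
  exists (half_at k i); first by rewrite Xji; apply: specializes_var.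
  by rewrite /half_at; case: eqP => // ik; case: (Xk j); rewrite Xji ik.
have [L' L'0 XjL'] := pos_X j.
(* The expansion that computes the d-vector is the positive one. *)
have LL' : L = L' by apply: (leval_inj clx); rewrite -XjL.
exists (laurent_at augmentation (half_at k) L); first by exists L.
have [a aL ak] := Lmin k.
apply: (le_trans _ (laurent_at_ge_monomial (half_at_gt0 k) _ aL)); last first.
  by rewrite LL'.
rewrite monomial_at_half ak exprz_inv opprK.
by rewrite -(gez0_abs (d0 k)) -exprnP exprn_ege1.
Qed.

(** If x_k were not in X, the monomial of exponent a would have value
    (1/2)^a_k < 1, whereas its term of exponent b in X has value at least 1. *)
Lemma shared_variable a k L b :
  (forall m, NP (coef m L)) -> lmonom x a = leval X L -> nonneg_expt a ->
  b \in supp L -> nonneg_expt b -> 0 < a k -> exists j, X j = x k.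
Proof.
move=> L0 eL /forallP a0 bL bn ak; apply: contrapT => nex.
have Xk j : X j <> x k by move=> e; apply: nex; exists j.
have /boolp.choice[p pX] j : exists q : rat,
    specializes x augmentation (half_at k) (X j) q /\ 1 <= q.
  by have [q] := specialization_ge1 Xk j; exists q.
have p0 j : 0 < p j by apply: lt_le_trans (pX j).2.
have half0 i : half_at k i != 0 by rewrite gt_eqF ?half_at_gt0.
have val_f : 2^-1 ^ a k = laurent_at augmentation p L.
  apply: (specializes_laurent clx half0 (cluster_neq0 clX)) => [j|j|].
  - by rewrite gt_eqF.
  - exact: (pX j).1.
  rewrite -eL -monomial_at_half; apply: specializes_monomial => //.
  by move=> i; apply: specializes_var.
have : 1 <= 2^-1 ^ a k :> rat.
  rewrite val_f; apply: le_trans (laurent_at_ge_monomial p0 L0 bL).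
  apply: (monomial_at_closed (S := fun q => 1 <= q)) => // [u v|i _].
    exact: mulr_ege1.
  exact: (pX i).2.
rewrite -(gtz0_abs ak) -exprnP leNgt exprn_ilt1 // -lt0n.
by rewrite absz_gt0 gt_eqF.
Qed.

Lemma cluster_monomial_proper f :
  cluster_monomial x f -> ~ cluster_monomial X f -> proper_combination X f.
Proof.
move=> [a an ->] nX.
have [L L0 eL] : pos_laurent X (lmonom x a).
  apply: (monomial_at_closed _ _ _ an) => //; first exact: pos_laurent1.
  by move=> u v; apply: pos_laurentM.
exists L => // b bL; apply/negP => bn; apply: nX.
apply: (monomial_at_closed _ _ _ an) => // [||k ak].
- exact: cluster_monomial1.
- by move=> u v; apply: cluster_monomialM.
have [j <-] := shared_variable L0 eL an bL bn ak.
exact: cluster_monomial_var.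
Qed.

End TwoClusters.

(** * Linear independence *)

(** In a cluster where f0 is the monomial of exponent b, the coefficient at b of
    a combination of cluster monomials is the coefficient of f0. *)
Lemma proper_laurent_independent (T : Type) (M : T -> 'I_n -> F) :
  (forall t, cluster (M t)) -> proper_laurent M ->
  lin_independent (cluster_monomials M).
Proof.
move=> clM proper s c us sM s0 f0 f0s; have [t [b bn f0b]] := sM f0 f0s.
have lmonomE a : lmonom (M t) a = leval (M t) (single 1 a).
  by rewrite levalE /laurent_at monalg.mmapU /= rmorph1 mul1r.
(* E f is the expansion of f in the cluster of f0. *)
have /boolp.choice[E EP] f : exists L : laurent dom n,
    f \in s -> f = leval (M t) L /\ coef b L = (f == f0)%:R.
  case: (pselect (f \in s)) => [fs|nfs]; last by exists 0.
  have [[a an fa]|nCM] := pselect (cluster_monomial (M t) f).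
    exists (single 1 a) => _; rewrite -lmonomE mcoeffU; split=> //.
    congr (_ *+ nat_of_bool _); apply/eqP/eqP => [ab|ff0].
      by rewrite fa f0b ab.
    have /malgP /(_ a) : single 1 a = single 1 b :> laurent dom n.
      by apply: (leval_inj (clM t)); rewrite -!lmonomE -fa -f0b.
    rewrite mcoeffUU mcoeffU; case: eqP => // _ /eqP; rewrite oner_eq0 //.
  have [t' ft'] := sM f fs; have [L Ln fL] := proper t t' f ft' nCM.
  exists L => _; split=> //; case: eqP => [ff0|_].
    by case: nCM; exists b; rewrite ?ff0.
  by apply: mcoeff_outdom; apply/negP => /Ln; rewrite bn.
have /malgP /(_ b) : \sum_(f <- s) c f *: E f = 0 :> laurent dom n.
  apply: (leval_eq0 (clM t)); rewrite levalE raddf_sum -[RHS]s0.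
  rewrite big_seq [RHS]big_seq; apply: eq_bigr => f fs /=.
  by rewrite laurent_atZ -levalE -(EP f fs).1.
have -> : coef b (\sum_(f <- s) c f *: E f) = \sum_(f <- s) c f * (f == f0)%:R.
  rewrite raddf_sum big_seq [RHS]big_seq; apply: eq_bigr => f fs.
  by rewrite -(EP f fs).2 -monalg.mcoeffZ.
rewrite monalg.mcoeff0 (bigD1_seq f0) //= eqxx mulr1 big1 ?addr0 // => f.
by move=> /negbTE ->; rewrite mulr0.
Qed.

End Evaluation.

Theorem theorem3p3 (P : zmodType)
    (dom : GRing.integral_domain_axiom (group_ring P)) (n : nat)
    (T : Type) (M : T -> 'I_n -> rat_fun dom n) :
  GLP_pattern M -> positive_pattern M -> dvector_positive M ->
  proper_laurent M /\ lin_independent (cluster_monomials M).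
Proof.
move=> [clM _] pos dvec; have proper : proper_laurent M.
  move=> t0 t f; apply: cluster_monomial_proper => // j.
  by apply: dvec; exists t0, j.
by split=> //; apply: proper_laurent_independent.
Qed.
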